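(* Let $S$ be a left amenable bicancellative monoid, $S\curvearrowright X$ a surjective continuous $S$-action over a compact topological space $X$, and $\boldsymbol{\Gamma}_S=(\Gamma_S,\gamma)$ the group of right fractions of $S$. Then $$h(X,S)=h(X_{\boldsymbol{\Gamma}_S},\Gamma_S).$$
   Context: All semigroups (in particular all monoids and groups) are countable and discrete. A continuous action of a monoid $S$ on a topological space $X$ is a map $(s,x)\mapsto s\cdot x$ with $1_S\cdot x=x$, $s\cdot(t\cdot x)=(st)\cdot x$, and each map $x\mapsto s\cdot x$ continuous; it is surjective if each of these maps is surjective. $S$ is bicancellative if $ab=ac$ or $ba=ca$ implies $b=c$. A left cancellative semigroup $S$ is left amenable iff it has a left Følner sequence: a sequence $(F_n)_n$ of finite non-empty subsets of $S$ with $\lim_n |sF_n\triangle F_n|/|F_n|=0$ for every $s\in S$. A left amenable bicancellative monoid is left reversible ($sS\cap tS\neq\varnothing$ for all $s,t$), hence has a group of right fractions $\boldsymbol{\Gamma}_S=(\Gamma_S,\gamma)$: a group $\Gamma_S$ with an injective semigroup morphism $\gamma\colon S\to\Gamma_S$ such that every $g\in\Gamma_S$ is $\gamma(s)\gamma(t)^{-1}$ for some $s,t\in S$ (unique up to isomorphism). In this case $\Gamma_S$ is an amenable group. $X_{\boldsymbol{\Gamma}_S}=\{(x_h)_{h\in\Gamma_S}\in X^{\Gamma_S}: s\cdot x_h=x_{\gamma(s)h}\text{ for all }s\in S,h\in\Gamma_S\}$ with the subspace topology of the product topology and the shift action $(g\cdot\overline x)_h=x_{hg}$ of $\Gamma_S$.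 Entropy: for a surjective continuous action of a left amenable bicancellative monoid $T$ on a compact topological space $Y$, an open cover $\mathcal{U}$ of $Y$ and finite $F\subseteq T$, let $s^{-1}\mathcal{U}=\{s^{-1}(U):U\in\mathcal{U}\}$ (preimages under $y\mapsto s\cdot y$), and let $\mathcal{U}^F=\bigvee_{s\in F}s^{-1}\mathcal{U}$, where $\mathcal{U}\vee\mathcal{V}=\{U\cap V:U\in\mathcal{U},V\in\mathcal{V}\}$. $N(\mathcal{U})$ is the minimum cardinality of a subcover of $\mathcal{U}$. For a left Følner sequence $(F_n)_n$ of $T$, $h_{\mathcal{U}}(Y,T)=\lim_{n}\frac{1}{|F_n|}\log N(\mathcal{U}^{F_n})$, which exists, is finite and does not depend on $(F_n)_n$. The topological entropy is $h(Y,T)=\sup\{h_{\mathcal{U}}(Y,T):\mathcal{U}\text{ an open cover of }Y\}$.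
   Formalization: It is additionally assumed that X is Hausdorff or that X_Γ is compact; for a compact non-Hausdorff X the space X_Γ can fail to be compact, and then its entropy h(X_Γ, Γ_S) is not defined. *)

(* Defs.v *)
From HB Require Import structures.
From mathcomp Require Import all_boot all_order all_algebra finmap.
From mathcomp Require Import all_classical all_reals all_analysis.

Set Implicit Arguments.
Unset Strict Implicit.
Unset Printing Implicit Defensive.

Import Order.TTheory GRing.Theory Num.Theory.
Import numFieldNormedType.Exports.

Local Open Scope classical_set_scope.
Local Open Scope ring_scope.

Definition bicancellative (S : monoidType) : Prop :=
  forall a b c : S, (a * b = a * c \/ b * a = c * a)%g -> b = c.

Definition left_folner (R : realType) (S : monoidType) (F : nat -> {fset S}) : Prop :=
  (forall n, F n != fset0) /\
  forall s : S,
    (fun n => let sF := [fset (s * x)%g | x in F n]%fset in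
       #|` (sF `\` F n) `|` (F n `\` sF)|%fset%:R / #|` F n|%:R : R)
      @ \oo --> (0 : R).

Definition left_amenable (R : realType) (S : monoidType) : Prop :=
  exists F : nat -> {fset S}, left_folner R F.

Definition is_right_fractions (S : monoidType) (G : groupType)
    (gamma : {multiplicative S -> G}) : Prop :=
  injective gamma /\ forall g : G, exists s t : S, g = (gamma s / gamma t)%g.

Definition is_action (S : monoidType) (X : Type) (act : S -> X -> X) : Prop :=
  (forall x, act 1%g x = x) /\
  (forall s t x, act s (act t x) = act (s * t)%g x).

Definition surjective_continuous_action (S : monoidType) (X : topologicalType)
    (act : S -> X -> X) : Prop :=
  [/\ is_action act, forall s, continuous (act s) &
      forall s, set_surj setT setT (act s)].

Section Entropy.
Context (R : realType) (T : monoidType) (Y : topologicalType).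
Variable act : T -> Y -> Y.

Definition open_cover (U : set (set Y)) : Prop :=
  (forall A, U A -> open A) /\ cover U id = [set: Y].

Definition cover_join (U V : set (set Y)) : set (set Y) :=
  [set A `&` B | A in U & B in V].

(* U^F; the empty join is the trivial cover {Y}. *)
Definition cover_pow (U : set (set Y)) (F : {fset T}) : set (set Y) :=
  \big[cover_join/[set [set: Y]]]_(s <- F) [set act s @^-1` A | A in U].

Definition has_subcover (U : set (set Y)) (n : nat) : Prop :=
  exists V : {fset set Y},
    [/\ [set` V] `<=` U, cover [set` V] id = [set: Y] & #|` V| = n].

(* Meaningful for covers with a finite subcover, in particular for every open
   cover of a compact space. *)
Definition cover_number (U : set (set Y)) : nat :=
  get [set n | has_subcover U n /\ forall m, has_subcover U m -> (n <= m)%N].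

(* The common limit along all left Folner sequences. If T is left amenable, at
   most one real l has this property. *)
Definition cover_entropy (U : set (set Y)) : R :=
  get [set l : R | forall F : nat -> {fset T}, left_folner R F ->
    (fun n => ln (cover_number (cover_pow U (F n)))%:R / #|` F n|%:R)
      @ \oo --> l].

Definition topological_entropy : \bar R :=
  ereal_sup [set (cover_entropy U)%:E | U in open_cover].

End Entropy.

Section Localization.
Context (S : monoidType) (X : topologicalType) (act : S -> X -> X).
Context (G : groupType) (gamma : {multiplicative S -> G}).

(* A set in the product space X^G; as a type it carries the subspace topology.
   It is compact if X is compact Hausdorff, but not for every compact X. *)
Definition localization : set {ptws G -> X} :=
  [set x | forall s h, act s (x h) = x (gamma s * h)%g].

Lemma localization_shift (g : G) (x : localization) :
  ((fun h => set_val x (h * g)%g) : {ptws G -> X}) \in localization.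
Proof.
apply: mem_set => s h /=.
by have /set_mem /(_ s (h * g)%g) -> := valP x; rewrite mulgA.
Qed.

Definition localization_act (g : G) (x : localization) : localization :=
  exist (fun y => y \in localization) _ (localization_shift g x).

End Localization.

Arguments localization_act {S X} act {G} gamma g x.

(* Main.v *)
Require Import Defs.
From mathcomp Require Import all_boot all_order all_algebra finmap.
From mathcomp Require Import all_classical all_reals all_analysis.
From mathcomp Require Import ring lra.

(* Two facts carry the proof. First, the defining limits exist and agree for all
   left Folner sequences of G = Gamma_S (Ornstein-Weiss): a very invariant set E
   is filled, up to a small proportion, by almost disjoint right translates of
   sets F_n on which log N(U^F)/|F| is nearly minimal, and log N(U^F) is
   subadditive and invariant under right translation. Since gamma maps left
   Folner sequences of S to left Folner sequences of G, this also gives the limits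
   over S. Secondly, the coordinate p : x |-> x_1 from X_G to X is onto, because S is
   countable and G = gamma(S) gamma(S)^-1, so the covers U of X and p^-1 U of X_G
   have equal entropies. Finally, as finitely many elements of G have a common
   denominator t, every open cover V of X_G is refined by the preimage of an open
   cover U of X under the coordinate g = gamma(t)^-1; this bounds N(V^F) by
   N((p^-1 U)^(g F)), and g F_n is again left Folner. *)

Set Implicit Arguments.
Unset Strict Implicit.
Unset Printing Implicit Defensive.

Import Order.TTheory GRing.Theory Num.Theory.
Import numFieldNormedType.Exports.

Local Open Scope classical_set_scope.
Local Open Scope ring_scope.

(** * Ornstein-Weiss convergence *)

Section Invariance.
Local Open Scope fset_scope.
Local Open Scope ring_scope.
Context (G : groupType).
Implicit Types (k g c : G) (A B E F : {fset G}) (K : seq G).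

Definition ltrans g A : {fset G} := [fset (g * x)%g | x in A].
Definition rtrans A c : {fset G} := [fset (x * c)%g | x in A].

(** Half of the Følner defect: [k A] minus [A] is [k] times this set, and [A] minus [k A] is
    [escape k^-1 A]. *)
Definition escape k A : {fset G} := [fset x in A | (k * x)%g \notin A].
(** Summing over a list makes the boundary additive under concatenation, so one bound for [K ++ F]
    controls both [K] and [F]. *)
Definition boundary K A : nat := \sum_(k <- K) #|` escape k A|.

Lemma mem_escape k A x :
  (x \in escape k A) = (x \in A) && ((k * x)%g \notin A).
Proof. by rewrite !inE. Qed.

Lemma mem_rtrans A c x : (x \in rtrans A c) = ((x / c)%g \in A).
Proof.
apply/imfsetP/idP => [[y yA ->]|xA]; first by rewrite mulgK.
by exists (x / c)%g => //; rewrite mulgVK.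
Qed.

Lemma mem_ltrans g A x : (x \in ltrans g A) = ((g^-1 * x)%g \in A).
Proof.
apply/imfsetP/idP => [[y yA ->]|xA]; first by rewrite mulKg.
by exists (g^-1 * x)%g => //; rewrite mulVKg.
Qed.

Lemma card_rtrans A c : #|` rtrans A c| = #|` A|.
Proof. by rewrite card_imfset //; exact: mulIg. Qed.

Lemma card_ltrans g A : #|` ltrans g A| = #|` A|.
Proof. by rewrite card_imfset //; exact: mulgI. Qed.

(** Left multiplication by [k] maps the points of [A] that stay in [A] under [k] onto those that
    stay under [k^-1]; both sides count the complements in [A]. *)
Lemma card_escapeV k A : #|` escape k^-1 A| = #|` escape k A|.
Proof.
pose stay := [fset x in A | (k * x)%g \in A].
have escE h : escape h A = A `\` [fset x in A | (h * x)%g \in A].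
  by apply/fsetP => x; rewrite !inE; case: (x \in A); rewrite ?andbT ?andbF /=.
rewrite !escE !cardfsD.
have -> : A `&` [fset x in A | (k^-1 * x)%g \in A] = ltrans k stay.
  apply/fsetP => x; rewrite mem_ltrans !inE mulVKg.
  by case: (x \in A); rewrite ?andbT ?andbF.
have -> : A `&` stay = stay.
  by apply/fsetP => x; rewrite !inE; case: (x \in A).
by rewrite card_ltrans.
Qed.

Lemma escape_rtrans k A c : escape k (rtrans A c) = rtrans (escape k A) c.
Proof. by apply/fsetP => x; rewrite mem_escape !mem_rtrans mem_escape mulgA. Qed.

Lemma card_escapeU k A B :
  (#|` escape k (A `|` B)| <= #|` escape k A| + #|` escape k B|)%N.
Proof.
apply: leq_trans (_ : (#|` escape k A `|` escape k B| <= _)%N).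
  apply: fsubset_leq_card; apply/fsubsetP => x.
  rewrite !inE negb_or => /andP[/orP[]-> /andP[-> ->]] //.
  by rewrite !andbT orbT.
by rewrite cardfsU leq_subr.
Qed.

(** If [x] leaves [E] minus [A] under [k], then [k x] either is outside [E] or lies in [A]; in the
    second case [k x] escapes from [A] under [k^-1], and [card_escapeV] applies. *)
Lemma card_escapeD k E A : A `<=` E ->
  (#|` escape k (E `\` A)| <= #|` escape k E| + #|` escape k A|)%N.
Proof.
move=> AE; rewrite -(card_escapeV k A) -(card_ltrans k^-1%g (escape _ A)).
apply: leq_trans (_ : (#|` escape k E `|` ltrans k^-1%g (escape k^-1%g A)| <= _)%N).
  apply: fsubset_leq_card; apply/fsubsetP => x.
  rewrite inE mem_ltrans !mem_escape !inE invgK mulKg.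
  case/andP => /andP[-> ->] /=.
  by case: ((k * x)%g \in E) => //=; rewrite andbT negbK => ->.
by rewrite cardfsU leq_subr.
Qed.

Lemma boundary_rtrans K A c : boundary K (rtrans A c) = boundary K A.
Proof. by apply: eq_bigr => k _; rewrite escape_rtrans card_rtrans. Qed.

Lemma boundaryU K A B : (boundary K (A `|` B) <= boundary K A + boundary K B)%N.
Proof. by rewrite -big_split; apply: leq_sum => k _; apply: card_escapeU. Qed.

Lemma boundaryD K E A : A `<=` E ->
  (boundary K (E `\` A) <= boundary K E + boundary K A)%N.
Proof.
by move=> AE; rewrite -big_split; apply: leq_sum => k _; apply: card_escapeD.
Qed.

Lemma boundary0 K : boundary K fset0 = 0%N.
Proof.
rewrite /boundary big1 // => k _; apply/eqP; rewrite cardfs_eq0.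
by apply/eqP/fsetP => x; rewrite !inE.
Qed.

(* Union bound over the k in F with k c outside E. *)
Lemma card_translates F E :
  (#|` E| <= #|` [fset c in E | rtrans F c `<=` E]| + boundary F E)%N.
Proof.
set C := [fset c in E | _].
have : (#|` E `\` C| <= boundary F E)%N.
  have sub : E `\` C `<=` \bigcup_(k <- F) escape k E.
    apply/fsubsetP => c; rewrite !inE negb_and => /andP[nC cE].
    move: nC; rewrite cE /= => /fsubsetPn[x]; rewrite mem_rtrans => xF xE.
    apply/bigfcupP; exists (x / c)%g; first by rewrite xF.
    by rewrite mem_escape cE mulgVK.
  apply: leq_trans (fsubset_leq_card sub) _; rewrite /boundary.
  elim/big_rec2: _ => [|k n U _ le]; first by rewrite cardfs0.
  by rewrite cardfsU (leq_trans (leq_subr _ _)) // leq_add2l.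
rewrite -leq_subLR; apply: leq_trans.
by rewrite cardfsD leq_sub2l // fsubset_leq_card // fsubsetIr.
Qed.

(* Double counting of the pairs (c, x) with c in C and x in F c and A. *)
Lemma sum_card_translates F A (C : {fset G}) :
  (\sum_(c <- C) #|` rtrans F c `&` A| <= #|` F| * #|` A|)%N.
Proof.
have cardE (B : {fset G}) (P : pred G) :
    #|` [fset x in B | P x]| = (\sum_(x <- B) P x)%N.
  rewrite -big_mkcond /= sum1_count -size_filter; apply/perm_size.
  apply: uniq_perm; rewrite ?filter_uniq ?fset_uniq // => x.
  by rewrite mem_filter !inE andbC.
under eq_bigr => c _.
  have -> : rtrans F c `&` A = [fset x in A | (x / c)%g \in F].
    by apply/fsetP => x; rewrite !inE mem_rtrans andbC.
  rewrite cardE; over.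
rewrite exchange_big /= mulnC -sum1_size big_distrl /=.
apply: leq_sum => x _; rewrite -cardE mul1n.
set B := [fset c in C | _].
have <- : #|` [fset (x / c)%g | c in B]| = #|` B|.
  by rewrite card_imfset //; exact: divgI.
apply: fsubset_leq_card; apply/fsubsetP => y /imfsetP[c /=].
by rewrite !inE => /andP[_ ?] ->.
Qed.

End Invariance.

Lemma max_fsubset (T : choiceType) (E : {fset T}) (P : {fset T} -> Prop) :
  P fset0 ->
  exists A, [/\ (A `<=` E)%fset, P A &
    forall B, (B `<=` E)%fset -> P B -> (#|` B| <= #|` A|)%N].
Proof.
move=> P0; pose Q n := `[< exists A, [/\ (A `<=` E)%fset, P A & #|` A| = n] >].
have exQ : exists n, Q n by exists 0%N; apply/asboolP; exists fset0; split.
have leQ n : Q n -> (n <= #|` E|)%N.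
  by move=> /asboolP[A [AE _ <-]]; exact: fsubset_leq_card.
case: (ex_maxnP exQ leQ) => n /asboolP[A [AE PA <-]] max.
by exists A; split=> // B BE PB; apply: max; apply/asboolP; exists B.
Qed.

(** * Almost filling invariant sets and convergence of subadditive functions *)

Section OrnsteinWeiss.
Local Open Scope fset_scope.
Local Open Scope ring_scope.
Context (R : realType) (G : groupType).
Implicit Types (A B E F : {fset G}) (K : seq G) (Fn En : nat -> {fset G}).

(** One-sided form of the Følner condition; [card_escapeV] supplies the other half. *)
Definition folner Fn : Prop := (forall n, Fn n != fset0) /\
  forall (g : G) (e : R), 0 < e ->
    \forall n \near \oo, #|` escape g (Fn n)|%:R <= e * #|` Fn n|%:R.

Lemma folner_boundary Fn K (e : R) : folner Fn -> 0 < e ->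
  \forall n \near \oo, (boundary K (Fn n))%:R <= e * #|` Fn n|%:R.
Proof.
move=> [_ foF]; elim: K e => [|k K IH] e e0.
  by near=> n; rewrite /boundary big_nil mulr_ge0 // ltW.
have e2 : 0 < e / 2 by rewrite divr_gt0.
near=> n; rewrite /boundary big_cons natrD [e]splitr mulrDl lerD //.
  by near: n; exact: foF.
by near: n; exact: IH.
Unshelve. all: by end_near. Qed.

Variable f : {fset G} -> R.
Hypothesis f0 : f fset0 = 0.
Hypothesis f_ge0 : forall A, 0 <= f A.
Hypothesis fU : forall A B, f (A `|` B) <= f A + f B.
Hypothesis fr : forall A c, f (rtrans A c) = f A.

(** Every singleton is a right translate of [[fset 1%g]]. *)
Lemma subadditive_card A : f A <= f [fset 1%g] * #|` A|%:R.
Proof.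
elim/fset1U_rect: A => [|x A xA IH]; first by rewrite f0 cardfs0 mulr0.
rewrite cardfsU1 xA natrD mulrDr mulr1 (le_trans (fU _ _)) // lerD //.
rewrite -(fr [fset 1%g] x); suff -> : rtrans [fset 1%g] x = [fset x] by [].
by apply/fsetP => y; rewrite mem_rtrans !inE divg_eq mul1g.
Qed.

(* Instead of a maximal family of almost disjoint translates of F, take A of
   maximal cardinality among the subsets of E satisfying the two bounds: any
   translate inside E overlaps A in a proportion e, since otherwise it could be
   added to A. Double counting then shows that A fills a proportion e of E. *)
Lemma greedy_translates K F E (e M b : R) :
  F != fset0 -> 0 < e -> e < 1 -> 0 <= M -> 0 <= b ->
  f F <= M * (1 - e) * #|` F|%:R ->
  (boundary K F)%:R <= b * (1 - e) * #|` F|%:R ->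
  exists A, [/\ A `<=` E, f A <= M * #|` A|%:R,
    (boundary K A)%:R <= b * #|` A|%:R &
    e * (#|` E|%:R - (boundary F E)%:R) <= #|` A|%:R].
Proof.
move=> Fn0 e0 e1 M0 b0 fF bF.
have Fpos : (0 : R) < #|` F|%:R by rewrite ltr0n cardfs_gt0.
have [|A [AE [fA bA] maxA]] := @max_fsubset _ E (fun A =>
    f A <= M * #|` A|%:R /\ (boundary K A)%:R <= b * #|` A|%:R).
  by rewrite f0 boundary0 cardfs0 !mulr0.
exists A; split=> //.
have overlap c : rtrans F c `<=` E ->
    e * #|` F|%:R <= #|` rtrans F c `&` A|%:R.
  move=> FE; rewrite leNgt; apply/negP => small.
  have cardU : #|` A `|` rtrans F c|%:R =
      #|` A|%:R + #|` F|%:R - #|` rtrans F c `&` A|%:R :> R.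
    by rewrite cardfsU natrB ?natrD ?card_rtrans ?(fsetIC A) //
      -(card_rtrans F c) (leq_trans (fsubset_leq_card (fsubsetIl _ _))) ?leq_addl.
  have := maxA (A `|` rtrans F c).
  rewrite fsubUset AE FE => /(_ isT) /= le.
  suff /le : f (A `|` rtrans F c) <= M * #|` A `|` rtrans F c|%:R /\
      (boundary K (A `|` rtrans F c))%:R <= b * #|` A `|` rtrans F c|%:R.
    rewrite -(ler_nat R) cardU; nra.
  (* An overlap below [e * #|F|] means that the union gains more than [(1 - e) * #|F|] points,
     exactly what the factors [1 - e] in the bounds on [F] pay for. *)
  split.
    apply: le_trans (fU _ _) _; rewrite fr cardU.
    nra.
  apply: (@le_trans _ _ ((boundary K A)%:R + (boundary K (rtrans F c))%:R)).
    by rewrite -natrD ler_nat boundaryU.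
  rewrite boundary_rtrans cardU; nra.
set C := [fset c in E | rtrans F c `<=` E].
have EC : #|` E|%:R - (boundary F E)%:R <= #|` C|%:R :> R.
  by rewrite lerBlDr -natrD ler_nat card_translates.
have CA : #|` C|%:R * (e * #|` F|%:R) <= #|` F|%:R * #|` A|%:R.
  apply: (@le_trans _ _ (\sum_(c <- C) #|` rtrans F c `&` A|)%:R).
    rewrite natr_sum -sum1_size natr_sum mulr_suml big_seq [leRHS]big_seq.
    by apply: ler_sum => c; rewrite !inE mul1r => /andP[_ /overlap].
  by rewrite -natrM ler_nat sum_card_translates.
apply: (@le_trans _ _ (e * #|` C|%:R)); first by rewrite ler_wpM2l // ltW.
by rewrite -(ler_pM2l Fpos); lra.
Qed.

(** Induction invariant of the exhaustion. [K] and [dl] are fixed before [E], so the requirement can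
    be imposed again on the part of [E] left over. *)
Definition almost_filled (M a : R) : Prop :=
  exists K (dl : R), 0 < dl /\ forall E,
    (boundary K E)%:R <= dl * #|` E|%:R ->
    exists A, [/\ A `<=` E, f A <= M * #|` A|%:R &
      #|` E `\` A|%:R <= a * #|` E|%:R].

(* Fill a proportion e / 2 of E by translates of one very invariant F_n. If the
   part of E that is left is not yet small, it is still invariant enough to be
   filled up to the proportion a. *)
Lemma almost_filled_step Fn (l e M a : R) : folner Fn ->
  (forall N, exists n, (N <= n)%N /\ f (Fn n) <= l * #|` Fn n|%:R) ->
  0 < e -> e < 1 -> 0 <= M -> l <= M * (1 - e) -> 0 < a ->
  almost_filled M a -> almost_filled M ((1 - e / 2) * a).
Proof.
move=> foF lF e0 e1 M0 lM a0 [K [dl [dl0 fill]]].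
set a' := (1 - e / 2) * a.
have a'0 : 0 < a' by rewrite mulr_gt0 //; lra.
(* The boundaries of [E] and [A] will each be at most [b * #|E|], together [dl * a' * #|E|]; this is
   within [dl] times the size of the remainder as long as the latter exceeds [a' * #|E|]. *)
pose b := dl * a' / 2.
have b0 : 0 < b by rewrite divr_gt0 // mulr_gt0.
have be0 : 0 < b * (1 - e) by rewrite mulr_gt0 //; lra.
have [N _ bF] := folner_boundary K foF be0.
have [n [Nn fF]] := lF N; have {}bF := bF n Nn.
(* The bound [2^-1] on the boundary for [Fn n] ensures that at least half of [E] consists of centers
   of translates inside [E], whence the filled proportion [e / 2]. *)
exists (K ++ Fn n), (Num.min b 2^-1); split; first by rewrite lt_min b0 invr_gt0 ltr0n.
move=> E bE; have {}bE : (boundary K E)%:R + (boundary (Fn n) E)%:R <=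
    Num.min b 2^-1 * #|` E|%:R by rewrite -natrD /boundary -big_cat.
have cE : (0 : R) <= #|` E|%:R by [].
have minb : Num.min b 2^-1 <= b by rewrite ge_min lexx.
have min2 : Num.min b 2^-1 <= 2^-1 by rewrite ge_min lexx orbT.
have bK : (boundary K E)%:R <= b * #|` E|%:R.
  apply: (le_trans _ (ler_wpM2r cE minb));
    by rewrite (le_trans _ bE) // lerDl ler0n.
have bF' : (boundary (Fn n) E)%:R <= 2^-1 * #|` E|%:R :> R.
  apply: (le_trans _ (ler_wpM2r cE min2));
    by rewrite (le_trans _ bE) // lerDr ler0n.
have [||A [AE fA bA eA]] := @greedy_translates K (Fn n) E e M b (foF.1 n) e0 e1 M0 (ltW b0).
- by apply: le_trans fF _; rewrite ler_wpM2r.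
- exact: bF.
have cEA : #|` E `\` A|%:R = #|` E|%:R - #|` A|%:R :> R.
  by rewrite cardfsD natrB ?fsubset_leq_card ?fsubsetIl // (fsetIidPr AE).
have [small|big] := leP (#|` E `\` A|%:R : R) (a' * #|` E|%:R).
  by exists A; split.
have cA : #|` A|%:R <= #|` E|%:R :> R by rewrite ler_nat fsubset_leq_card.
have [|A' [A'E fA' aA']] := fill (E `\` A).
  apply: (@le_trans _ _ ((boundary K E)%:R + (boundary K A)%:R)).
    by rewrite -natrD ler_nat boundaryD.
  apply: (@le_trans _ _ (dl * (a' * #|` E|%:R))); last by rewrite ler_wpM2l // ltW.
  have := ler_wpM2l (ltW b0) cA; move: bK bA; rewrite /b; lra.
exists (A `|` A'); split.
- by rewrite fsubUset AE (fsubset_trans A'E) // fsubsetDl.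
- apply: le_trans (fU _ _) _.
  apply: (@le_trans _ _ (M * (#|` A|%:R + #|` A'|%:R))); first by lra.
  rewrite ler_wpM2l // -natrD ler_nat cardfsU (_ : A `&` A' = fset0) ?cardfs0 ?subn0 //.
  apply/fsetP => x; rewrite !inE; apply/negP => /andP[xA /(fsubsetP A'E)].
  by rewrite !inE xA.
- rewrite -fsetDDl; apply: le_trans aA' _; rewrite cEA /a'.
  rewrite mulrAC mulrC ler_wpM2r ?(ltW a0) //.
  have : e * (2^-1 * #|` E|%:R) <= e * (#|` E|%:R - (boundary (Fn n) E)%:R).
    by rewrite ler_wpM2l ?(ltW e0) //; lra.
  lra.
Qed.

Lemma almost_filled_expr Fn (l e M : R) n : folner Fn ->
  (forall N, exists n, (N <= n)%N /\ f (Fn n) <= l * #|` Fn n|%:R) ->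
  0 < e -> e < 1 -> 0 <= M -> l <= M * (1 - e) ->
  almost_filled M ((1 - e / 2) ^+ n).
Proof.
move=> foF lF e0 e1 M0 lM; elim: n => [|n IH].
  exists [::], 1; split=> // E _; exists fset0.
  by rewrite fsub0set f0 cardfs0 mulr0 fsetD0 mul1r.
rewrite exprS; apply: (almost_filled_step foF lF) => //.
by rewrite exprn_gt0 //; lra.
Qed.

(** Iterated filling covers all but a proportion [eta] of each late [En m] by a set on which [f] has
    density at most [M]; the rest is estimated by [subadditive_card]. *)
Lemma ornstein_weiss_le Fn En (l l' : R) : folner Fn -> folner En -> l < l' ->
  (forall N, exists n, (N <= n)%N /\ f (Fn n) <= l * #|` Fn n|%:R) ->
  \forall n \near \oo, f (En n) <= l' * #|` En n|%:R.
Proof.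
move=> foF foE ll' lF.
have l0 : 0 <= l.
  have [n [_ le]] := lF 0%N.
  have Fpos : (0 : R) < #|` Fn n|%:R by rewrite ltr0n cardfs_gt0 foF.1.
  by rewrite -(pmulr_lge0 _ Fpos) (le_trans (f_ge0 (Fn n))) // mulrC.
(* The choice of [e] gives [M * (1 - e) = (M + l) / 2], which lies above [l]. *)
pose M := (l + l') / 2; pose e := (M - l) / (2 * M).
have M0 : 0 < M by rewrite /M; lra.
have lM : l < M by rewrite /M; lra.
have e0 : 0 < e by rewrite divr_gt0 //; lra.
have eM : e * M = (M - l) / 2 by rewrite /e; field; rewrite gt_eqF.
have e1 : e < 1 by rewrite -(ltr_pM2r M0) eM; lra.
have lMe : l <= M * (1 - e) by rewrite mulrBr mulr1 [M * e]mulrC eM; lra.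
(* The unfilled points may cost [(l' - M) * #|En m|] in total, each at most [f [fset 1%g]]; the
   [+ 1] avoids a zero denominator. *)
pose eta := (l' - M) / (f [fset 1%g] + 1).
have f1 := f_ge0 [fset 1%g].
have eta0 : 0 < eta by rewrite divr_gt0 //; rewrite /M; lra.
have [n small] : exists n, (1 - e / 2) ^+ n <= eta.
  have /cvgr0Pnorm_le /(_ _ eta0)[n _ /(_ n)] : (fun n => (1 - e / 2) ^+ n) @ \oo --> (0 : R).
    by apply: cvg_expr; rewrite ger0_norm; lra.
  by move=> /(_ (leqnn n)) /= le; exists n; apply: le_trans le; exact: ler_norm.
have [K [dl [dl0 fill]]] := almost_filled_expr n foF lF e0 e1 (ltW M0) lMe.
near=> m.
have [|A [AE fA rest]] := fill (En m).
  by near: m; exact: folner_boundary.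
have cA : #|` A|%:R <= #|` En m|%:R :> R by rewrite ler_nat fsubset_leq_card.
have EA : f (En m) <= f A + f (En m `\` A).
  have := fU A (En m `\` A); suff -> : A `|` (En m `\` A) = En m by [].
  apply/fsetP => x; rewrite !inE; have := fsubsetP AE x.
  by case: (x \in A) => [/(_ isT) ->|_].
have feta : f [fset 1%g] * eta <= l' - M.
  rewrite /eta mulrCA ler_piMr //; first by rewrite /M; lra.
  by rewrite ler_pdivrMr ?mul1r; lra.
have cE : (0 : R) <= #|` En m|%:R by rewrite ler0n.
have rest' : #|` En m `\` A|%:R <= eta * #|` En m|%:R.
  by apply: le_trans rest _; rewrite ler_wpM2r.
have := le_trans (subadditive_card (En m `\` A)) (ler_wpM2l f1 rest').
have := ler_wpM2r cE feta.
have := ler_wpM2l (ltW M0) cA.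
lra.
Unshelve. all: by end_near. Qed.

Theorem ornstein_weiss Fn : folner Fn -> exists l : R, forall En, folner En ->
  (fun n => f (En n) / #|` En n|%:R) @ \oo --> l.
Proof.
move=> foF.
(* The infimum of [L] is the lower limit of the quotients along [Fn]. *)
pose L := [set l : R | forall N, exists n, (N <= n)%N /\ f (Fn n) <= l * #|` Fn n|%:R].
have L1 : L (f [fset 1%g]) by move=> N; exists N; split=> //; exact: subadditive_card.
have L0 : lbound L 0.
  move=> l /(_ 0%N)[n [_ le]].
  have Fpos : (0 : R) < #|` Fn n|%:R by rewrite ltr0n cardfs_gt0 foF.1.
  by rewrite -(pmulr_lge0 _ Fpos) (le_trans (f_ge0 (Fn n))) // mulrC.
have infL : has_inf L by split; [exists (f [fset 1%g]) | exists 0].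
exists (inf L) => En foE; apply/cvgrPdist_le => e e0.
have e2 : 0 < e / 2 by rewrite divr_gt0.
have [l Ll lL] := inf_adherent e2 infL.
have upper : \forall n \near \oo, f (En n) <= (inf L + e) * #|` En n|%:R.
  by apply: (ornstein_weiss_le foF foE _ Ll); lra.
have lower : \forall n \near \oo, (inf L - e) * #|` En n|%:R <= f (En n).
  (* Here the roles of [Fn] and [En] are exchanged: low values recurring along [En] would force
     eventually low values along [Fn], putting a number below [inf L] into [L]. *)
  apply: contrapT => nlower.
  have often N : exists n, (N <= n)%N /\ f (En n) <= (inf L - e) * #|` En n|%:R.
    apply: contrapT => none; apply: nlower; exists N => // n /= Nn.
    by rewrite leNgt; apply/negP => /ltW lt; apply: none; exists n.
  have lt2 : inf L - e < inf L - e / 2 by lra.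
  have [N _ FN] := ornstein_weiss_le foE foF lt2 often.
  have : L (inf L - e / 2).
    move=> n; exists (maxn N n); split; first exact: leq_maxr.
    by apply: FN => /=; exact: leq_maxl.
  by move/(ge_inf infL.2); lra.
near=> n.
have Epos : (0 : R) < #|` En n|%:R by rewrite ltr0n cardfs_gt0 foE.1.
rewrite ler_norml lerBrDl lerBlDl.
have up : f (En n) / #|` En n|%:R <= inf L + e.
  by rewrite ler_pdivrMr //; near: n.
have low : inf L - e <= f (En n) / #|` En n|%:R.
  by rewrite ler_pdivlMr //; near: n.
by apply/andP; split; lra.
Unshelve. all: by end_near. Qed.

End OrnsteinWeiss.

(** * Følner sequences of monoids and of groups *)

Section LeftFolner.
Local Open Scope fset_scope.
Local Open Scope ring_scope.
Context (R : realType).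

Lemma left_folnerP (S : monoidType) (F : nat -> {fset S}) :
  left_folner R F <-> (forall n, F n != fset0) /\ forall (s : S) (e : R), 0 < e ->
  \forall n \near \oo, let sF := [fset (s * x)%g | x in F n] in
    #|` (sF `\` F n) `|` (F n `\` sF)|%:R <= e * #|` F n|%:R.
Proof.
split=> -[F0 foF]; split=> // s.
  move=> e e0; have /cvgr0Pnorm_le/(_ e e0) := foF s.
  apply: filterS => n /=; rewrite ger0_norm ?divr_ge0 //.
  by rewrite ler_pdivrMr // ltr0n cardfs_gt0.
apply/cvgr0Pnorm_le => e e0; apply: filterS (foF s e e0) => n /=.
by rewrite ger0_norm ?divr_ge0 // ler_pdivrMr // ltr0n cardfs_gt0.
Qed.

Lemma folner_left_folner (G : groupType) (F : nat -> {fset G}) :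
  folner R F -> left_folner R F.
Proof.
move=> [F0 foF]; apply/left_folnerP; split=> // s e e0.
have e2 : 0 < e / 2 by rewrite divr_gt0.
near=> n; rewrite /= -/(ltrans s (F n)).
have -> : ltrans s (F n) `\` F n = ltrans s (escape s (F n)).
  by apply/fsetP => x; rewrite !(inE, mem_ltrans, mem_escape) mulVKg andbC.
have -> : F n `\` ltrans s (F n) = escape s^-1%g (F n).
  by apply/fsetP => x; rewrite !(inE, mem_ltrans, mem_escape) andbC.
apply: (@le_trans _ _ (#|` escape s (F n)|%:R + #|` escape s^-1%g (F n)|%:R)).
  by rewrite -natrD ler_nat cardfsU card_ltrans leq_subr.
by rewrite card_escapeV [e]splitr mulrDl lerD //; near: n; exact: foF.
Unshelve. all: by end_near. Qed.

(** Suppose [gamma y], with [y] in [F n], escapes under [gamma s / gamma t]. Either [y] is not in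
    [t F n], or [y = t z] with [z] in [F n] and [s z] outside [F n]. So the defects of [t] and [s]
    bound the escape. *)
Lemma left_folner_fractions (S : monoidType) (G : groupType)
    (gamma : {multiplicative S -> G}) (F : nat -> {fset S}) :
  is_right_fractions gamma -> left_folner R F ->
  folner R (fun n => [fset gamma x | x in F n]).
Proof.
move=> [gI fracG] /left_folnerP[F0 foF]; split=> [n|g e e0].
  have /fset0Pn[x xF] := F0 n; apply/fset0Pn; exists (gamma x).
  exact: in_imfset.
have [s [t ->]] := fracG g.
have e2 : 0 < e / 2 by rewrite divr_gt0.
pose D n (s : S) := let sF := [fset (s * x)%g | x in F n] in
  (sF `\` F n) `|` (F n `\` sF).
near=> n; set A := [fset gamma x | x in F n].
have -> : #|` A| = #|` F n| by rewrite card_imfset.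
have esc : (#|` escape (gamma s / gamma t)%g A| <= #|` D n s| + #|` D n t|)%N.
  pose U := [fset (gamma t / gamma s * gamma y)%g | y in D n s].
  pose V := [fset gamma y | y in D n t].
  have UV : escape (gamma s / gamma t)%g A `<=` U `|` V.
    apply/fsubsetP => x; rewrite mem_escape => /andP[/imfsetP[y /= yF ->]] nA.
    have [/imfsetP[z /= zF yE]|ytF] := boolP (y \in [fset (t * x)%g | x in F n]).
      rewrite inE; apply/orP; left; apply/imfsetP; exists (s * z)%g => /=.
        move: nA; rewrite yE gmulfM mulgA mulgVK -gmulfM => nA.
        rewrite !inE in_imfset //= andbT; apply/orP; left.
        by apply: contra nA => ?; rewrite in_imfset.
      by rewrite yE !gmulfM mulgA mulgVK.
    rewrite inE; apply/orP; right; apply/imfsetP; exists y => //=.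
    by rewrite !inE yF ytF orbT.
  apply: leq_trans (fsubset_leq_card UV) _.
  rewrite cardfsU (leq_trans (leq_subr _ _)) // leq_add //.
    by rewrite card_imfset // => x y /mulgI /gI.
  by rewrite card_imfset.
apply: (@le_trans _ _ (#|` D n s|%:R + #|` D n t|%:R)).
  by rewrite -natrD ler_nat.
by rewrite [e]splitr mulrDl lerD //; near: n; exact: foF.
Unshelve. all: by end_near. Qed.

Lemma folner_ltrans (G : groupType) (F : nat -> {fset G}) g :
  folner R F -> folner R (fun n => ltrans g (F n)).
Proof.
move=> [F0 foF]; split=> [n|h e e0].
  have /fset0Pn[x xF] := F0 n; apply/fset0Pn; exists (g * x)%g.
  exact: in_imfset.
have := foF (g^-1 * h * g)%g e e0; apply: filterS => n.
have -> : escape h (ltrans g (F n)) = ltrans g (escape (g^-1 * h * g)%g (F n)).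
  by apply/fsetP => x; rewrite !(mem_escape, mem_ltrans) !mulgA mulgK.
by rewrite !card_ltrans.
Qed.

End LeftFolner.

(** * Covers and refinement *)

Section Refinement.
Local Open Scope fset_scope.
Local Open Scope ring_scope.
Context (Y : topologicalType).
Implicit Types (U V W C : set (set Y)) (n m : nat).

Definition refines U V : Prop := forall A, U A -> exists2 B, V B & (A `<=` B)%classic.

Lemma refines_refl U : refines U U.
Proof. by move=> A UA; exists A. Qed.

Lemma refines_trans V U W : refines U V -> refines V W -> refines U W.
Proof.
move=> UV VW A /UV[B /VW[C WC BC] AB]; exists C => //; exact: subset_trans BC.
Qed.

(* cover_number W is the least n with this property; unlike has_subcover it is
   monotone in W for refinement. *)
Definition coverable W n : Prop :=
  exists V : {fset set Y},
    [/\ (#|` V| <= n)%N, cover [set` V] id = setT & refines [set` V] W].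

Lemma coverable_refines U W n : refines U W -> coverable U n -> coverable W n.
Proof.
move=> UW [V [Vn Vcov VU]]; exists V; split=> //; exact: refines_trans VU UW.
Qed.

Lemma coverable_subcover W n :
  coverable W n -> exists2 m, (m <= n)%N & has_subcover W m.
Proof.
move=> [V [Vn Vcov VW]].
have [phi phiP] : {phi : set Y -> set Y &
    forall A, A \in V -> W (phi A) /\ (A `<=` phi A)%classic}.
  apply: (@choice _ _ (fun A B => A \in V -> W B /\ (A `<=` B)%classic)) => A.
  have [/VW[B WB AB]|nV] := pselect (A \in V); first by exists B.
  by exists A.
exists #|` [fset phi A | A in V]|.
  by apply: leq_trans Vn; exact: leq_imfset_card.
exists [fset phi A | A in V]; split=> //.
  by move=> B /imfsetP[A /= /phiP[? _] ->].
apply/seteqP; split=> // y _.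
have : cover [set` V] id y by rewrite Vcov.
move=> [A AV Ay]; exists (phi A); first exact: in_imfset.
by have [_] := phiP A AV; apply.
Qed.

Lemma subcover_coverable W n : has_subcover W n -> coverable W n.
Proof.
move=> [V [VW Vcov Vn]]; exists V; split=> //; first by rewrite Vn.
by move=> A /VW WA; exists A.
Qed.

(** [cover_number] is a chosen value, so its defining property first needs some finite subcover. *)
Lemma cover_numberP W n : coverable W n ->
  has_subcover W (cover_number W) /\ forall m, has_subcover W m -> (cover_number W <= m)%N.
Proof.
move=> /coverable_subcover[m _ Wm].
have ex : exists m, `[< has_subcover W m >] by exists m; apply/asboolP.
apply: (@getPex _ [set n | has_subcover W n /\ forall m, has_subcover W m -> (n <= m)%N]).
case: (ex_minnP ex) => k /asboolP Wk mink; exists k; split=> // p Wp.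
by apply: mink; apply/asboolP.
Qed.

Lemma cover_number_le W n : coverable W n -> (cover_number W <= n)%N.
Proof.
move=> Wn; have [_ min] := cover_numberP Wn.
by have [m mn /min le] := coverable_subcover Wn; exact: leq_trans mn.
Qed.

Lemma coverable_number W n : coverable W n -> coverable W (cover_number W).
Proof. by move=> /cover_numberP[/subcover_coverable]. Qed.

Lemma refines_join C U W :
  refines C (cover_join U W) <-> refines C U /\ refines C W.
Proof.
split=> [CUW|[CU CW] A CA].
  split=> A /CUW[_ [B UB [D WD <-]] AB]; [exists B | exists D] => // y /AB [] //.
have [B UB AB] := CU A CA; have [D WD AD] := CW A CA.
exists (B `&` D)%classic; first by exists B => //; exists D.
by move=> y Ay; split; [exact: AB|exact: AD].
Qed.

Lemma coverable_join U W n m :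
  coverable U n -> coverable W m -> coverable (cover_join U W) (n * m).
Proof.
move=> [V1 [V1n V1c V1U]] [V2 [V2m V2c V2W]].
exists (seq_fset imfset_key [seq (A `&` B)%classic | A <- V1, B <- V2]); split.
- rewrite size_seq_fset (leq_trans (size_undup _)) // size_allpairs.
  exact: leq_mul.
- apply/seteqP; split=> // y _.
  have : cover [set` V1] id y by rewrite V1c.
  have : cover [set` V2] id y by rewrite V2c.
  move=> [B BV By] [A AV Ay]; exists (A `&` B)%classic => //=.
  by rewrite seq_fsetE; apply/allpairsP; exists (A, B).
- move=> C; rewrite /= seq_fsetE => /allpairsP[[A B] /=].
  move=> [/V1U[A' UA' AA'] /V2W[B' WB' BB'] ->].
  exists (A' `&` B')%classic; last exact: setISS.
  by exists A' => //; exists B'.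
Qed.

End Refinement.

Section Preimage.
Local Open Scope fset_scope.
Local Open Scope ring_scope.
Context (Y Z : topologicalType) (phi : Y -> Z).

Definition cover_preimage (U : set (set Z)) : set (set Y) := [set phi @^-1` A | A in U].

Lemma coverable_preimage (U : set (set Z)) n :
  coverable U n -> coverable (cover_preimage U) n.
Proof.
move=> [V [Vn Vc VU]]; exists [fset phi @^-1` A | A in V]; split.
- by apply: leq_trans Vn; exact: leq_imfset_card.
- apply/seteqP; split=> // y _.
  have : cover [set` V] id (phi y) by rewrite Vc.
  by move=> [A AV Ay]; exists (phi @^-1` A) => //; exact: in_imfset.
- move=> _ /imfsetP[A /= /VU[B UB AB] ->].
  by exists (phi @^-1` B); [exists B | exact: preimage_subset].
Qed.

(** Since [phi] is onto, the images of a cover of [Y] cover [Z]. This shows that pulling covers back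
    along [phi] does not lower cover numbers. *)
Lemma coverable_image (W : set (set Y)) (U : set (set Z)) n :
  set_surj setT setT phi -> refines [set (phi @` A)%classic | A in W] U ->
  coverable W n -> coverable U n.
Proof.
move=> surj WU [V [Vn Vc VW]]; exists [fset (phi @` A)%classic | A in V]; split.
- by apply: leq_trans Vn; exact: leq_imfset_card.
- apply/seteqP; split=> // z _; have [y _ <-] := surj z I.
  have : cover [set` V] id y by rewrite Vc.
  move=> [A AV Ay]; exists ((phi @` A)%classic); first exact: in_imfset.
  by exists y.
- move=> _ /imfsetP[A /= /VW[B WB AB] ->].
  have [|C UC BC] := WU (phi @` B)%classic; first by exists B.
  by exists C => //; apply: subset_trans BC; exact: image_subset.
Qed.

End Preimage.

(** * Joins of a cover along finite sets *)

Section Powers.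
Local Open Scope fset_scope.
Local Open Scope ring_scope.
Context (T : monoidType) (Y : topologicalType) (act : T -> Y -> Y).
Implicit Types (U W C : set (set Y)) (F E : {fset T}).

(** Universal property of the join; later comparisons of cover powers go through it one element of
    [F] at a time. *)
Lemma refines_pow C U F : refines C (cover_pow act U F) <->
  forall s, s \in F -> refines C (cover_preimage (act s) U).
Proof.
rewrite /cover_pow /=.
have -> : (forall s, s \in F -> refines C (cover_preimage (act s) U)) <->
    forall s, s \in (F : seq T) -> refines C (cover_preimage (act s) U) by [].
elim: (F : seq T) => [|s l IH].
  by rewrite big_nil; split=> // _ A _; exists setT.
rewrite big_cons refines_join IH; split=> [[Cs Cl] t|CF].
  by rewrite inE => /predU1P[->|/Cl].
by split=> [|t tl]; apply: CF; rewrite inE ?eqxx // tl orbT.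
Qed.

Lemma pow_refines U F s : s \in F -> refines (cover_pow act U F) (cover_preimage (act s) U).
Proof. by move=> sF; apply: (refines_pow _ _ _).1 sF; exact: refines_refl. Qed.

Lemma coverable_pow U F n : coverable U n -> exists m, coverable (cover_pow act U F) m.
Proof.
move=> Un; rewrite /cover_pow; elim: (F : seq T) => [|s l [m IH]].
  rewrite big_nil; exists 1%N, [fset setT]; split; first by rewrite cardfs1.
    by apply/seteqP; split=> // y _; exists setT => //=; rewrite inE.
  by move=> A _; exists setT.
rewrite big_cons; exists (n * m)%N; apply: coverable_join => //.
exact: (@coverable_preimage _ _ (act s)).
Qed.

Lemma coverable_pow_number U F n : coverable U n ->
  coverable (cover_pow act U F) (cover_number (cover_pow act U F)).
Proof. by move=> /(coverable_pow F)[m /coverable_number]. Qed.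

Context (R : realType).

Definition log_cover_number U F : R := ln (cover_number (cover_pow act U F))%:R.

(** The convention [ln 0 = 0] matters: an empty space has cover number 0. *)
Lemma ln_nat_ge0 n : 0 <= ln (n%:R : R).
Proof. by case: n => [|n]; [rewrite ln0 | rewrite ln_ge0 // ler1n]. Qed.

Lemma ler_ln_nat n m : (n <= m)%N -> ln (n%:R : R) <= ln m%:R.
Proof.
case: n => [_|n nm]; first by rewrite ln0 // ln_nat_ge0.
by rewrite ler_ln ?posrE ?ltr0n ?ler_nat //; exact: leq_trans nm.
Qed.

Lemma log_cover_number_ge0 U F : 0 <= log_cover_number U F.
Proof. exact: ln_nat_ge0. Qed.

Lemma log_cover_number0 U : log_cover_number U fset0 = 0.
Proof.
apply/le_anti; rewrite log_cover_number_ge0 andbT -[leRHS]ln1.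
apply: (@ler_ln_nat _ 1); apply: cover_number_le.
exists [fset setT]; split; first by rewrite cardfs1.
  by apply/seteqP; split=> // y _; exists setT => //=; rewrite inE.
by apply/refines_pow => s; rewrite inE.
Qed.

Lemma log_cover_numberU U F E n : coverable U n ->
  log_cover_number U (F `|` E) <= log_cover_number U F + log_cover_number U E.
Proof.
move=> Un.
have NF := coverable_pow_number F Un; have NE := coverable_pow_number E Un.
have : (cover_number (cover_pow act U (F `|` E)) <=
    cover_number (cover_pow act U F) * cover_number (cover_pow act U E))%N.
  apply: cover_number_le; apply: coverable_refines (coverable_join NF NE).
  apply/refines_pow => s; have /refines_join[JF JE] := @refines_refl _
    (cover_join (cover_pow act U F) (cover_pow act U E)).
  rewrite inE => /orP[sF|sE].
    exact: refines_trans JF (pow_refines sF).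
  exact: refines_trans JE (pow_refines sE).
move=> /ler_ln_nat; rewrite /log_cover_number.
case: (cover_number (cover_pow act U F)) => [|p].
  by move=> le; apply: le_trans le _; rewrite mul0n ln0 // add0r ln_nat_ge0.
case: (cover_number (cover_pow act U E)) => [|q].
  by move=> le; apply: le_trans le _; rewrite muln0 ln0 // addr0 ln_nat_ge0.
by rewrite natrM lnM ?posrE ?ltr0n.
Qed.

End Powers.

Lemma log_cover_number_le (R : realType) (T T' : monoidType) (Y Y' : topologicalType)
    (act : T -> Y -> Y) (act' : T' -> Y' -> Y') U F U' F' n : coverable U' n ->
  (forall n, coverable (cover_pow act' U' F') n -> coverable (cover_pow act U F) n) ->
  log_cover_number act R U F <= log_cover_number act' R U' F'.
Proof.
move=> U'n le; apply: ler_ln_nat; apply: cover_number_le; apply: le.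
exact: (coverable_pow_number act' F' U'n).
Qed.

(** * Entropy of a cover under a group action *)

Section GroupAction.
Context (R : realType) (G : groupType) (Y : topologicalType) (act : G -> Y -> Y).
Hypothesis actP : is_action act.
Variable U : set (set Y).
Hypothesis finU : exists n, coverable U n.

(** Acting by [s c] is acting by [c], then by [s], so preimages under [c] turn coverings for [F]
    into coverings for [F c]; translating back by [c^-1] gives equality. *)
Lemma log_cover_number_rtrans (F : {fset G}) c :
  log_cover_number act R U (rtrans F c) = log_cover_number act R U F.
Proof.
have [n Un] := finU.
have le E d : log_cover_number act R U (rtrans E d) <= log_cover_number act R U E.
  apply: log_cover_number_le Un _ => m /(coverable_preimage (act d)).
  apply: coverable_refines; apply/refines_pow => s; rewrite mem_rtrans.
  move=> /(@pow_refines _ _ act U) ref _ [A /ref[_ [B UB <-] AB] <-].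
  exists (act s @^-1` B); first by exists B.
  by move=> y /AB; rewrite /preimage /= actP.2 mulgVK.
apply/le_anti; rewrite le /=.
have {1}-> : F = rtrans (rtrans F c) c^-1%g.
  by apply/fsetP => x; rewrite !mem_rtrans invgK mulgK.
exact: le.
Qed.

Lemma cover_entropy_exists (F0 : nat -> {fset G}) : folner R F0 ->
  exists l : R, forall F, folner R F ->
    (fun n => log_cover_number act R U (F n) / #|` F n|%:R) @ \oo --> l.
Proof.
have [n Un] := finU; apply: ornstein_weiss.
- exact: log_cover_number0.
- exact: log_cover_number_ge0.
- by move=> A B; exact: log_cover_numberU Un.
- exact: log_cover_number_rtrans.
Qed.

End GroupAction.

(** A common limit [l] gives the chosen value its defining property, and the one sequence [F0] then
    identifies it with [l]. *)
Lemma cover_entropyE (R : realType) (T : monoidType) (Y : topologicalType)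
    (act : T -> Y -> Y) (U : set (set Y)) (l : R) (F0 : nat -> {fset T}) : left_folner R F0 ->
  (forall F, left_folner R F ->
    (fun n => log_cover_number act R U (F n) / #|` F n|%:R) @ \oo --> l) ->
  cover_entropy R act U = l.
Proof.
move=> foF0 lim; rewrite /cover_entropy; set P := [set l : R | _].
have /(_ _ foF0) Pl : P (get P) by apply: getPex; exists l.
exact: (cvg_unique _ Pl (lim _ foF0)).
Qed.

(** * Localization *)

Section Fractions.
Context (S : monoidType) (G : groupType) (gamma : {multiplicative S -> G}).
Hypothesis gammaP : is_right_fractions gamma.

(** Write [gamma(s)^-1 gamma(t)] as [gamma(u) gamma(v)^-1] and clear denominators. *)
Lemma ore s t : exists u v : S, (s * u = t * v)%g.
Proof.
have [gI fracG] := gammaP; have [u [v e]] := fracG ((gamma s)^-1 * gamma t)%g.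
exists u, v; apply: gI; rewrite !gmulfM.
by apply: (mulgI (gamma s)^-1%g); rewrite mulKg mulgA e mulgVK.
Qed.

Lemma common_denominator (E : {fset G}) :
  exists t : S, forall h, h \in E -> exists s, h = (gamma s / gamma t)%g.
Proof.
elim/fset1U_rect: E => [|h E _ [t tE]]; first by exists 1%g.
have [s [r hE]] := gammaP.2 h; have [u [v uv]] := ore t r.
exists (t * u)%g => k; rewrite !inE => /predU1P[->|/tE[s' ->]].
  by exists (s * v)%g; rewrite uv hE !gmulfM mulgKA.
by exists (s' * u)%g; rewrite !gmulfM mulgKA.
Qed.

End Fractions.

Section Compactness.
Context (Y : topologicalType).

(** Otherwise the complements of finite unions from [U] generate a proper filter; a cluster point
    lies in some [A] of [U], although the complement of [A] is in the filter. *)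
Lemma compact_finite_subcover (U : set (set Y)) : compact [set: Y] -> open_cover U ->
  exists V : {fset set Y}, [set` V] `<=` U /\ cover [set` V] id = setT.
Proof.
move=> cY [Uo Uc]; apply: contrapT => none.
pose D := [set V : {fset set Y} | [set` V] `<=` U].
pose F := filter_from D (fun V => ~` cover [set` V] id).
have PF : ProperFilter F.
  apply: filter_from_proper; last first.
    move=> V DV; apply: contrapT => nV; apply: none; exists V; split=> //.
    apply/seteqP; split=> // y _; apply: contrapT => nVy; apply: nV.
    by exists y.
  apply: filter_from_filter; first by exists fset0 => A; rewrite /= inE.
  move=> V W DV DW; exists (V `|` W)%fset.
    by move=> A; rewrite /= inE => /orP[/DV|/DW].
  by move=> y nVW; split=> -[A AV Ay]; apply: nVW; exists A => //=; rewrite inE AV ?orbT.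
have [y [_ Fy]] := cY F PF filterT.
have : cover U id y by rewrite Uc.
move=> [A UA Ay].
have FA : F (~` A).
  exists [fset A]%fset; first by move=> B; rewrite /= inE => /eqP ->.
  by move=> z nz Az; apply: nz; exists A => //=; rewrite inE.
have [z [nAz Az]] := Fy _ _ FA (open_nbhs_nbhs (conj (Uo _ UA) Ay)).
exact: nAz.
Qed.

Lemma compact_coverable (U : set (set Y)) : compact [set: Y] -> open_cover U ->
  exists n, coverable U n.
Proof.
move=> cY oU; have [V [VU Vc]] := compact_finite_subcover cY oU.
by exists #|` V|, V; split=> // A /VU UA; exists A.
Qed.

End Compactness.

(** * Topology, coordinates and covers of X_G *)

Section Localization.
Context (S : monoidType) (X : topologicalType) (act : S -> X -> X).
Context (G : groupType) (gamma : {multiplicative S -> G}).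
Hypothesis gammaP : is_right_fractions gamma.
Hypothesis actP : surjective_continuous_action act.

Notation L := (localization act gamma : Type).

Definition loc_coord (h : G) (x : L) : X := (set_val x : G -> X) h.

Lemma loc_coord_act g h (x : L) :
  loc_coord h (localization_act act gamma g x) = loc_coord (h * g)%g x.
Proof. by []. Qed.

Lemma loc_coordE s h (x : L) : loc_coord (gamma s * h)%g x = act s (loc_coord h x).
Proof. by have /set_mem /(_ s h) := valP x. Qed.

Lemma localization_is_action : is_action (localization_act act gamma).
Proof.
split=> [x|s t x]; apply: val_inj; apply/funext => h /=.
  by rewrite mulg1.
by rewrite mulgA.
Qed.

Lemma loc_coord_continuous h : continuous (loc_coord h).
Proof.
move=> x; apply: (@continuous_comp _ _ _ (set_val : L -> {ptws G -> X}) (@proj G (fun=> X) h)).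
  exact: initial_continuous.
exact: proj_continuous.
Qed.

Lemma localization_cvg (F : set_system L) (x : L) : Filter F ->
  (forall h, loc_coord h @ F --> loc_coord h x) -> F --> x.
Proof.
move=> FF cvgF A /= [_ [[C Cop <-] Cx CA]].
have : (set_val @ F) --> (set_val x : {ptws G -> X}).
  apply/cvg_sup => h B [_ [[D Dop <-] Dx DB]].
  have FD : F (loc_coord h @^-1` D) by apply: (cvgF h D); apply: open_nbhs_nbhs; split.
  by apply: (@filterS _ F _ (loc_coord h @^-1` D)) => // y; exact: DB.
move=> /(_ C (open_nbhs_nbhs (conj Cop Cx))) FC.
exact: (@filterS _ F FF (set_val @^-1` C)).
Qed.

(* Each coordinate is a function of the coordinate at gamma(t)^-1 as soon as t
   is a denominator, so these coordinates alone generate the topology. *)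
Lemma localization_base (O : set L) x : open O -> O x ->
  exists t A, [/\ open A, A (loc_coord (gamma t)^-1 x) &
    loc_coord (gamma t)^-1 @^-1` A `<=` O].
Proof.
move=> Oop Ox.
pose D := [set p : S * set X | open p.2 /\ p.2 (loc_coord (gamma p.1)^-1 x)].
(* The filter generated by the neighbourhoods of [x] of the required form; the claim is its
   convergence to [x]. *)
pose F := filter_from D (fun p => loc_coord (gamma p.1)^-1 @^-1` p.2).
(* Enlarging the denominator from [t] to [t u] only replaces [A] by its preimage under [u], so by
   [ore] two such sets can share a denominator. *)
have restrict t u (A : set X) : D (t, A) ->
    D ((t * u)%g, act u @^-1` A) /\
    loc_coord (gamma (t * u)%g)^-1 @^-1` (act u @^-1` A) = loc_coord (gamma t)^-1 @^-1` A.
  have tuE y : act u (loc_coord (gamma (t * u)%g)^-1 y) = loc_coord (gamma t)^-1 y.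
    by rewrite -loc_coordE gmulfM invgM mulVKg.
  have [_ cact _] := actP.
  move=> [/= Aop Ax]; split; last by apply/funext => y; rewrite /preimage /= tuE.
  split=> /=; last by rewrite /preimage /= tuE.
  by apply: open_comp => // y _; exact: cact.
have FF : Filter F.
  apply: filter_from_filter; first by exists (1%g, setT); split=> //=; exact: openT.
  move=> [t A] [r B] DA DB; have [u [v uv]] := ore gammaP t r.
  have [[Aop Ax] <-] := restrict _ u _ DA; have [] := restrict _ v _ DB.
  rewrite -uv => -[Bop Bx] /= <-.
  exists ((t * u)%g, act u @^-1` A `&` act v @^-1` B) => //=.
  by split=> //=; exact: openI.
have Fx : F --> x.
  apply: localization_cvg => h A; rewrite nbhsE => -[B [Bop Bx] BA].
  have [s [t hE]] := gammaP.2 h; have [_ cact _] := actP.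
  exists (t, act s @^-1` B).
    split=> /=; first by apply: open_comp => // y _; exact: cact.
    by rewrite /preimage /= -loc_coordE -hE.
  by move=> y /=; rewrite /preimage /= -loc_coordE -hE => /BA.
have [[t A] [Aop Ax] AO] := Fx _ (open_nbhs_nbhs (conj Oop Ox)).
by exists t, A.
Qed.

(** Tychonoff gives a cluster point [p] in the full product. Every neighbourhood of [p] meets X_G,
    so [act s (p h)] and [p (gamma s * h)] cannot be separated and agree in the Hausdorff space
    [X]. *)
Lemma localization_compact : compact [set: X] -> hausdorff_space X -> compact [set: L].
Proof.
move=> cX hX F PF _.
have [] := @tychonoff G (fun=> X) (fun=> setT) (fun=> cX)
  (set_val @ F : set_system (G -> X)) _.
  by apply: filterS filterT.
move=> p [_ clp].
have pL : localization act gamma p.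
  move=> s h; apply: hX => A B nA nB.
  have [_ cact _] := actP.
  have nAp : nbhs (p : {ptws G -> X}) [set y | A (act s (y h))].
    exact: (@proj_continuous G (fun=> X) h p _ (cact s _ _ nA)).
  have nBp : nbhs (p : {ptws G -> X}) [set y | B (y (gamma s * h)%g)].
    exact: (@proj_continuous G (fun=> X) (gamma s * h)%g p _ nB).
  have FL : (set_val @ F) (localization act gamma).
    apply: (@filterS _ F _ setT); last exact: filterT.
    by move=> y _; exact: set_valP.
  have [y [yL [Ay By]]] := clp _ _ FL (@filterI _ (nbhs (p : {ptws G -> X})) _ _ _ nAp nBp).
  by exists (act s (y h)); split=> //; rewrite yL.
exists (exist _ p (mem_set pL)); split=> // A B FA [_ [[C Cop <-] Cp CB]].
have FA' : (set_val @ F) (set_val @` A).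
  by apply: (@filterS _ F _ A) => //; exact: preimage_image.
have [_ [[y Ay <-] Cy]] := clp _ C FA' (open_nbhs_nbhs (conj Cop Cp)).
by exists y; split=> //; exact: CB.
Qed.

Hypothesis countS : countable [set: S].

(* Along a sequence t_0 = 1, t_(n+1) = t_n u_n absorbing every element of S as a
   left factor, choose y_0 = x and u_n y_(n+1) = y_n; the orbit is then
   x_h = w y_n whenever h gamma(t_n) = gamma(w). *)
Lemma loc_coord1_surj : set_surj setT setT (loc_coord 1%g : L -> X).
Proof.
move=> x _.
have [[act1 actM] _ surj] := actP.
have [gI fracG] := gammaP.
have /countable_injP[idx idxI] := countS.
have [e eE] : {e : nat -> S & forall n s, idx s = n -> s = e n}.
  apply: (@choice _ _ (fun n s' => forall s, idx s = n -> s = s')) => n.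
  have [[s sn]|none] := pselect (exists s, idx s = n).
    by exists s => s' s'n; apply: idxI; rewrite ?inE // sn.
  by exists 1%g => s sn; case: none; exists s.
have [nxt nxtP] : {nxt : nat * (S * X) -> S * X & forall p,
    act (nxt p).1 (nxt p).2 = p.2.2 /\
    exists v, (p.2.1 * (nxt p).1 = e p.1 * v)%g}.
  apply: (@choice _ _ (fun (p : nat * (S * X)) (q : S * X) => act q.1 q.2 = p.2.2 /\
    exists v, (p.2.1 * q.1 = e p.1 * v)%g)) => -[n [t y]] /=.
  have [u [v uv]] := ore gammaP t (e n); have [z _ zy] := surj u y I.
  by exists (u, z); split=> //; exists v.
pose sq := fix sq n : S * X := if n is m.+1 then
  let q := nxt (m, sq m) in ((sq m).1 * q.1, q.2)%g else (1%g, x).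
(* By [u_n y_(n+1) = y_n], passing to a later stage changes [w] but not the value [w y_n]. *)
have later n m h w : (n <= m)%N -> (h * gamma (sq n).1 = gamma w)%g ->
    exists w', (h * gamma (sq m).1 = gamma w')%g /\ act w' (sq m).2 = act w (sq n).2.
  move=> + hw; elim: m => [|m IH]; first by rewrite leqn0 => /eqP n0; exists w; rewrite -n0.
  rewrite leq_eqVlt => /predU1P[<-|/IH[w' [hw' ww']]]; first by exists w.
  exists (w' * (nxt (m, sq m)).1)%g; rewrite /= !gmulfM mulgA hw'; split=> //.
  by rewrite -actM (nxtP (m, sq m)).1.
pose val_at h z := exists n w, (h * gamma (sq n).1 = gamma w)%g /\ z = act w (sq n).2.
have functional h z z' : val_at h z -> val_at h z' -> z = z'.
  move=> [n [w [hw ->]]] [n' [w' [hw' ->]]].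
  have [a [ha <-]] := later _ (maxn n n') _ _ (leq_maxl _ _) hw.
  have [b [hb <-]] := later _ (maxn n n') _ _ (leq_maxr _ _) hw'.
  by congr act; apply: gI; rewrite -ha.
have total h : exists z, val_at h z.
  have [s [t ->]] := fracG h.
  (* The step from stage [idx t] to the next absorbs [t]: the new denominator is [t v], and
     [h = gamma s / gamma t] takes it to [gamma (s * v)]. *)
  have [_ [v tv]] := nxtP (idx t, sq (idx t)).
  exists (act (s * v)%g (sq (idx t).+1).2), (idx t).+1, (s * v)%g; split=> //=.
  by rewrite tv -(eE _ _ erefl) !gmulfM mulgA mulgVK.
have [p pE] := choice total.
have pL : localization act gamma p.
  move=> s h; apply: (functional (gamma s * h)%g) => //.
  have [n [w [hw ->]]] := pE h; exists n, (s * w)%g.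
  by rewrite -mulgA hw gmulfM actM.
exists (exist _ p (mem_set pL)) => //.
apply: (functional 1%g); first exact: pE.
by exists 0%N, 1%g; rewrite mul1g act1.
Qed.

Lemma loc_coord_surj h : set_surj setT setT (loc_coord h : L -> X).
Proof.
move=> x _; have [y _ yx] := loc_coord1_surj (I : setT x).
exists (localization_act act gamma h^-1%g y) => //.
by rewrite loc_coord_act mulgV.
Qed.

Lemma open_cover_coord h (U : set (set X)) :
  open_cover U -> open_cover (cover_preimage (loc_coord h : L -> X) U).
Proof.
move=> [Uo Uc]; split=> [_ [A UA <-]|].
  by apply: open_comp => [y _|]; [exact: loc_coord_continuous | exact: Uo].
apply/seteqP; split=> // y _.
have : cover U id (loc_coord h y) by rewrite Uc.
by move=> [A UA Ay]; exists (loc_coord h @^-1` A) => //; exists A.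
Qed.

Lemma refine_by_coord (V : set (set L)) : compact [set: L] -> open_cover V ->
  exists t U, open_cover U /\
    refines (cover_preimage (loc_coord (gamma t)^-1 : L -> X) U) V.
Proof.
move=> cL [Vo Vc].
pose P t (B : set L) := exists2 A, open A & B = loc_coord (gamma t)^-1 @^-1` A.
pose W := [set B : set L | (exists t, P t B) /\ exists2 C, V C & B `<=` C].
have oW : open_cover W.
  split=> [B [[t [A Aop ->]] _]|].
    by apply: open_comp => // y _; exact: loc_coord_continuous.
  apply/seteqP; split=> // x _; have : cover V id x by rewrite Vc.
  move=> [C VC Cx].
  have [t [A [Aop Ax AC]]] := localization_base (Vo _ VC) Cx.
  exists (loc_coord (gamma t)^-1 @^-1` A) => //; split; last by exists C.
  by exists t, A.
have [W0 [W0W W0c]] := compact_finite_subcover cL oW.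
have [den denP] : {den : set L -> S & forall B, B \in W0 -> P (den B) B}.
  apply: (@choice _ _ (fun B t => B \in W0 -> P t B)) => B.
  have [/W0W[[t Pt] _]|nB] := pselect (B \in W0); first by exists t.
  by exists 1%g.
have [t tP] := common_denominator gammaP [fset (gamma (den B))^-1%g | B in W0]%fset.
(* The largest choice of [U]: refinement of [V] is built in, and only covering remains, which is
   checked on points written as coordinates of points of X_G. *)
exists t, [set A | open A /\ exists2 C, V C & loc_coord (gamma t)^-1 @^-1` A `<=` C].
split; last by move=> _ [A [_ [C VC AC]] <-]; exists C.
split=> [A []//|]; apply/seteqP; split=> // x _.
have [y _ <-] := @loc_coord_surj (gamma t)^-1%g x I.
have : cover [set` W0] id y by rewrite W0c.
move=> [B BW By]; have [A Aop BA] := denP B BW.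
have [s sE] : exists s, ((gamma (den B))^-1 = gamma s / gamma t)%g.
  by apply: tP; exact: in_imfset.
have BsA : B = loc_coord (gamma t)^-1 @^-1` (act s @^-1` A).
  by rewrite BA sE; apply/funext => z; rewrite /preimage /= loc_coordE.
exists (act s @^-1` A); last by move: By; rewrite BsA.
split; first by have [_ cact _] := actP; apply: open_comp => // z _; exact: cact.
by have [_ [C VC BC]] := W0W B BW; exists C; rewrite -?BsA.
Qed.

Context (R : realType).
Notation actL := (localization_act act gamma).
Notation base_cover U := (cover_preimage (loc_coord 1%g : L -> X) U).

(** The coordinate at 1 intertwines [gamma s] with [s]. Preimages of coverings give one inequality;
    images, using surjectivity, give the other. *)
Lemma log_cover_number_coord1 (U : set (set X)) (F : {fset S}) n : coverable U n ->
  log_cover_number actL R (base_cover U) [fset gamma s | s in F]%fset =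
  log_cover_number act R U F.
Proof.
move=> Un; apply/le_anti/andP; split.
  apply: log_cover_number_le Un _ => m /(coverable_preimage (loc_coord 1%g : L -> X)).
  apply: coverable_refines; apply/refines_pow => _ /imfsetP[s /= sF ->].
  move=> _ [A /(pow_refines sF)[_ [B UB <-] AB] <-].
  exists (actL (gamma s) @^-1` (loc_coord 1%g @^-1` B)).
    by exists (loc_coord 1%g @^-1` B) => //; exists B.
  by move=> y /AB; rewrite /preimage /= loc_coord_act mul1g -loc_coordE mulg1.
apply: log_cover_number_le (coverable_preimage (loc_coord 1%g : L -> X) Un) _ => m.
apply: (coverable_image (@loc_coord_surj 1%g)).
apply/refines_pow => s sF _ [A WA <-].
have sF' : gamma s \in [fset gamma s | s in F]%fset by exact: in_imfset.
have [_ [_ [B UB <-] <-] AB] := pow_refines sF' WA.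
exists (act s @^-1` B); first by exists B.
by move=> _ [y /AB + <-]; rewrite /preimage /= loc_coord_act mul1g -loc_coordE mulg1.
Qed.

(** The coordinate at 1 after acting by [g s] is the coordinate at [g] after acting by [s]. *)
Lemma log_cover_number_coord (V : set (set L)) (U : set (set X)) (F : {fset G}) g n :
  coverable U n -> refines (cover_preimage (loc_coord g : L -> X) U) V ->
  log_cover_number actL R V F <= log_cover_number actL R (base_cover U) (ltrans g F).
Proof.
move=> Un UV.
apply: log_cover_number_le (coverable_preimage (loc_coord 1%g : L -> X) Un) _ => m.
apply: coverable_refines; apply/refines_pow => s sF A WA.
have gsF : (g * s)%g \in ltrans g F by exact: in_imfset.
have [_ [_ [B UB <-] <-] AB] := pow_refines gsF WA.
have [|C VC BC] := UV (loc_coord g @^-1` B); first by exists B.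
exists (actL s @^-1` C); first by exists C.
by move=> y /AB; rewrite /preimage /= loc_coord_act mul1g => By; apply: BC.
Qed.

End Localization.

Theorem proposition5p3 (R : realType)
  (S : monoidType)
  (hcount : countable [set: S]%classic)
  (hcancel : bicancellative S)
  (hamen : left_amenable R S)
  (X : topologicalType)
  (hcompact : compact [set: X]%classic)
  (act : S -> X -> X)
  (hact : surjective_continuous_action act)
  (G : groupType) (gamma : {multiplicative S -> G})
  (hgamma : is_right_fractions gamma)
  (hXG : hausdorff_space X \/ compact [set: localization act gamma]%classic) :
  topological_entropy R act =
  topological_entropy R (localization_act act gamma).
Proof.
have cL : compact [set: localization act gamma].
  by case: hXG => // hX; exact: localization_compact.
have [F0 foF0] := hamen.
have foG0 := left_folner_fractions hgamma foF0.
have lfoG0 := folner_left_folner foG0.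
have folnerG (F : nat -> {fset G}) : left_folner R F -> folner R F.
  (* A group is its own group of right fractions, so [left_folner_fractions] also converts
     [left_folner] to [folner] on [G]. *)
  have idP : is_right_fractions (idfun : {multiplicative G -> G}).
    by split=> // g; exists g, 1%g; rewrite /= divg1.
  move=> foF; have := left_folner_fractions idP foF.
  by congr (folner _ _); apply/funext => n; apply/fsetP => x; rewrite imfset_id.
set actL := localization_act act gamma.
have isL := localization_is_action act gamma.
pose U1 (U : set (set X)) := cover_preimage (loc_coord 1%g : localization act gamma -> X) U.
have oU1 U : open_cover U -> open_cover (U1 U) by exact: open_cover_coord.
have entropyL V : open_cover V -> forall F, folner R F ->
    (fun n => log_cover_number actL R V (F n) / #|` F n|%:R) @ \oo -->
      cover_entropy R actL V.
  move=> oV; have [l lP] := cover_entropy_exists isL (compact_coverable cL oV) foG0.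
  rewrite (cover_entropyE lfoG0 (l := l)) // => F /folnerG; exact: lP.
have same U : open_cover U -> cover_entropy R act U = cover_entropy R actL (U1 U).
  move=> oU; have [n Un] := compact_coverable hcompact oU.
  apply: (cover_entropyE foF0) => F foF.
  have eqk k : log_cover_number act R U (F k) / #|` F k|%:R =
      log_cover_number actL R (U1 U) [fset gamma s | s in F k]%fset /
        #|` [fset gamma s | s in F k]%fset|%:R.
    rewrite (log_cover_number_coord1 hgamma hact hcount R (F k) Un) card_imfset //.
    exact: hgamma.1.
  under eq_fun do rewrite eqk.
  exact: entropyL (oU1 _ oU) _ (left_folner_fractions hgamma foF).
apply/le_anti/andP; split; apply: ub_ereal_sup => _ [V oV <-].
  by rewrite same //; apply: ereal_sup_ubound; exists (U1 V) => //; exact: oU1.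
have [t [U [oU UV]]] := refine_by_coord hgamma hact hcount cL oV.
have [n Un] := compact_coverable hcompact oU.
apply: (@le_trans _ _ (cover_entropy R act U)%:E); last first.
  by apply: ereal_sup_ubound; exists U.
rewrite same // lee_fin.
have limV := entropyL _ oV _ foG0.
(* Translation by [gamma(t)^-1] keeps the Følner property and all cardinalities, so the termwise
   comparison of cover numbers passes to the limits. *)
have limU := entropyL _ (oU1 _ oU) _ (folner_ltrans (gamma t)^-1%g foG0).
apply: (ler_cvg_to limV limU); near=> k.
rewrite card_ltrans ler_wpM2r ?invr_ge0 ?ler0n //.
exact: log_cover_number_coord Un UV.
Unshelve. all: by end_near. Qed.
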